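(* Let $n\ge2$, let $f:\{0,1\}^n\times\{0,1\}^n\to\{0,1\}$ and let $\mu$ be a product distribution on $\{0,1\}^n\times\{0,1\}^n$. (1) $\mathsf{CC}^\mu_{0.49}(f)\le C\left(\left(\log\mathrm{srec}^\mu_{1/n^2,1/n^2}(f)\right)^2\log n + 1\right)$ for an absolute constant $C$. (2) If there is an integer $k\ge20$ and some $\delta\le 1/(3000(k+1)^4)$ with $\lceil 100\log\mathrm{srec}^\mu_{\delta,\delta}(f)\rceil\le k$, then $\mathsf{CC}^\mu_{0.49}(f)\le Ck^2$ for an absolute constant $C$.
   Context: A rectangle is $A\times B$ with $A\subseteq\mathcal X,B\subseteq\mathcal Y$. A distribution $\mu$ is product if $\mu(x,y)=\mu_X(x)\mu_Y(y)$. For a nonnegative function $\mu$ on $\mathcal X\times\mathcal Y$, write $\mu_z(R)=\mu(R\cap f^{-1}(z))$ and $\mu_z=\mu_z(\mathcal X\times\mathcal Y)$. $\mathrm{srec}^{z,\mu}_{\epsilon,\delta}(f)$ is the optimal value of the LP: minimize $\sum_R w_R$ over $w_R\ge0$ (one variable per rectangle) subject to $\sum_{(x,y)\in f^{-1}(z)}\mu(x,y)\sum_{R\ni(x,y)}w_R\ge(1-\epsilon)\mu_z$; $\sum_{R\ni(x,y)}w_R\le\delta$ for all $(x,y)\notin f^{-1}(z)$; $\sum_{R\ni(x,y)}w_R\le1$ for all $(x,y)$. $\mathrm{srec}^\mu_{\epsilon,\delta}(f)=\max_{z\in\{0,1\}}\mathrm{srec}^{z,\mu}_{\epsilon,\delta}(f)$.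 $\mathsf{CC}^\mu_\epsilon(f)$ is the minimum worst-case communication of a deterministic protocol computing $f$ with error at most $\epsilon$ under $\mu$. Logs base 2. *)

(* Defs.v *)
From Stdlib Require Import Reals ClassicalEpsilon.
From HB Require Import structures.
From mathcomp Require Import all_boot.

Set Implicit Arguments.
Unset Strict Implicit.
Unset Printing Implicit Defensive.

Local Open Scope R_scope.

Lemma Rplus_assoc' : associative Rplus.
Proof. by move=> a b c; rewrite Rplus_assoc. Qed.
HB.instance Definition _ :=
  Monoid.isComLaw.Build R R0 Rplus Rplus_assoc' Rplus_comm Rplus_0_l.

Definition rsum (T : finType) (P : pred T) (F : T -> R) : R :=
  \big[Rplus/R0]_(i : T | P i) F i.

Definition log2 (x : R) : R := ln x / ln 2.
Definition Rfloor (x : R) : Z := (up x - 1)%Z.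
Definition Rceil (x : R) : Z := (- Rfloor (- x))%Z.

Definition is_inf (S : R -> Prop) (v : R) : Prop :=
  (forall s, S s -> v <= s) /\ (forall b, (forall s, S s -> b <= s) -> b <= v).

Definition bits (n : nat) : finType := n.-tuple bool.

Section Comm.
Variables (X Y : finType).

Definition rect : finType := ({set X} * {set Y})%type.

Definition in_rect (Rc : rect) (x : X) (y : Y) : bool :=
  (x \in Rc.1) && (y \in Rc.2).

Definition product_distribution (mu : X -> Y -> R) : Prop :=
  (forall x y, 0 <= mu x y) /\
  rsum predT (fun p : X * Y => mu p.1 p.2) = 1 /\
  exists (muX : X -> R) (muY : Y -> R), forall x y, mu x y = muX x * muY y.

Definition mu_z (mu : X -> Y -> R) (f : X -> Y -> bool) (z : bool) : R :=
  rsum (fun p : X * Y => f p.1 p.2 == z) (fun p => mu p.1 p.2).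

Definition cover (w : rect -> R) (x : X) (y : Y) : R :=
  rsum (fun Rc : rect => in_rect Rc x y) w.

Definition srec_feasible (mu : X -> Y -> R) (f : X -> Y -> bool) (z : bool)
    (eps delta : R) (w : rect -> R) : Prop :=
  (forall Rc, 0 <= w Rc) /\
  rsum (fun p : X * Y => f p.1 p.2 == z) (fun p => mu p.1 p.2 * cover w p.1 p.2)
    >= (1 - eps) * mu_z mu f z /\
  (forall x y, f x y <> z -> cover w x y <= delta) /\
  (forall x y, cover w x y <= 1).

Definition srec_z (mu : X -> Y -> R) (f : X -> Y -> bool) (z : bool)
    (eps delta : R) : R :=
  epsilon (inhabits R0)
    (is_inf (fun s => exists w : rect -> R,
               srec_feasible mu f z eps delta w /\ s = rsum predT w)).

Definition srec (mu : X -> Y -> R) (f : X -> Y -> bool) (eps delta : R) : R :=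
  Rmax (srec_z mu f false eps delta) (srec_z mu f true eps delta).

Inductive protocol : Type :=
| Leaf : bool -> protocol
| AliceNode : (X -> bool) -> protocol -> protocol -> protocol
| BobNode : (Y -> bool) -> protocol -> protocol -> protocol.

(* Worst-case communication = depth of the protocol tree. *)
Fixpoint depth (p : protocol) : nat :=
  match p with
  | Leaf _ => 0
  | AliceNode _ p0 p1 => (maxn (depth p0) (depth p1)).+1
  | BobNode _ p0 p1 => (maxn (depth p0) (depth p1)).+1
  end.

Fixpoint run (p : protocol) (x : X) (y : Y) : bool :=
  match p with
  | Leaf b => b
  | AliceNode g p0 p1 => if g x then run p1 x y else run p0 x y
  | BobNode h p0 p1 => if h y then run p1 x y else run p0 x y
  end.

Definition error (mu : X -> Y -> R) (f : X -> Y -> bool) (p : protocol) : R :=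
  rsum (fun q : X * Y => run p q.1 q.2 != f q.1 q.2) (fun q => mu q.1 q.2).

Definition CC (mu : X -> Y -> R) (eps : R) (f : X -> Y -> bool) : nat :=
  epsilon (inhabits 0%nat)
    (fun d => (exists p, depth p = d /\ error mu f p <= eps) /\
              (forall p, error mu f p <= eps -> (d <= depth p)%N)).

End Comm.

(* Main.v *)
Require Import Defs.
From Stdlib Require Import Reals ClassicalEpsilon Classical Lra ZArith.
From mathcomp Require Import all_boot.

Set Implicit Arguments.
Unset Strict Implicit.
Unset Printing Implicit Defensive.

Local Open Scope R_scope.

(** Let [w false], [w true] be near-optimal solutions of the two linear programs.
    No point is covered much by both, so a rectangle of the 1-cover meets the
    0-cover in little mass. As the distribution is a product, Yannakakis' argument
    for clique versus independent set applies: relative to the current rectangle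
    [v], most 0-rectangles (weighted by mass) shrink by a factor of 4 either in the
    rows or in the columns of such a 1-rectangle. Moving the input into these rows
    (or columns) lowers the entropy-like potential
    [pot v = sum_S w_S mass(v∩S) ln (mass v / mass (v∩S))], which is nonnegative,
    superadditive under splitting, and initially [O(k)]; so [O(k)] such moves
    suffice on average. If no such 1-rectangle exists, then [v] is almost
    monochromatic. A move costs [O(k)] bits: [2 ^ O(k)] 1-rectangles of relative mass
    [2 ^ - O(k)] are tried in turn, and the first one that hits is found by binary
    search. Part (1) follows from part (2) and the trivial protocol, since
    [1 / n^2 <= 1 / (3000 (k + 1)^4)] unless [n = O(k^2)]. *)

(** * Finite sums and indicators *)

Definition ind (b : bool) : R := if b then 1 else 0.

Notation tsum := (rsum predT).

Lemma ind_ge0 b : 0 <= ind b.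
Proof. by case: b => /=; lra. Qed.

Lemma ind_and b c : ind (b && c) = ind b * ind c.
Proof. by case: b; case: c => /=; lra. Qed.

Section FiniteSums.
Variable T : finType.
Implicit Types (P : pred T) (F G : T -> R).

Lemma rsumE P F : rsum P F = tsum (fun i => ind (P i) * F i).
Proof.
rewrite /rsum big_mkcond; apply: eq_bigr => i _.
by case: (P i) => /=; lra.
Qed.

Lemma eq_tsum F G : (forall i, F i = G i) -> tsum F = tsum G.
Proof. by move=> FG; apply: eq_bigr => i _. Qed.

Lemma tsumD F G : tsum (fun i => F i + G i) = tsum F + tsum G.
Proof. exact: big_split. Qed.

Lemma tsumZ c F : tsum (fun i => c * F i) = c * tsum F.
Proof.
by rewrite /rsum; elim/big_rec2: _ => [|i x y _ ->]; lra.
Qed.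

Lemma tsumZr c F : tsum (fun i => F i * c) = tsum F * c.
Proof.
by rewrite /rsum; elim/big_rec2: _ => [|i x y _ ->]; lra.
Qed.

Lemma tsum_ge0 F : (forall i, 0 <= F i) -> 0 <= tsum F.
Proof.
move=> F0; rewrite /rsum; elim/big_rec: _ => [|i x _ ?]; first lra.
by have := F0 i; lra.
Qed.

Lemma ler_tsum F G : (forall i, F i <= G i) -> tsum F <= tsum G.
Proof.
move=> FG; rewrite /rsum; elim/big_rec2: _ => [|i x y _ ?]; first lra.
by have := FG i; lra.
Qed.

End FiniteSums.

Lemma exchange_tsum (S T : finType) (F : S -> T -> R) :
  tsum (fun i => tsum (F i)) = tsum (fun j => tsum (fun i => F i j)).
Proof. exact: exchange_big. Qed.

Lemma tsum_pair (S T : finType) (F : S -> T -> R) :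
  tsum (fun p : S * T => F p.1 p.2) = tsum (fun i => tsum (F i)).
Proof. by rewrite /rsum pair_big. Qed.

(** * Entropy inequalities for splitting in two *)

Lemma ln_le_sub1 z : 0 < z -> ln z <= z - 1.
Proof.
move=> z0; have := exp_ineq1_le (ln z).
by rewrite exp_ln //; lra.
Qed.

(* With [z = y m / q], these are [ln z <= z - 1] and, for [z >= 4],
   [ln z <= 3/4 z - 1]. *)
Lemma entropy_piece q m y (e : bool) : 0 <= q <= m -> 0 < y ->
  (e -> 4 * q <= y * m) ->
  q * ln (m / q) + ind e * (y * m / 4) <= q * ln (/ y) + y * m - q.
Proof.
move=> [q0 qm] y0 he; case: (Rle_lt_or_eq_dec _ _ q0) => [qgt|<-]; last first.
  have ym : 0 <= y * m by apply: Rmult_le_pos; lra.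
  by case: e {he} => /=; lra.
have m0 : 0 < m by lra.
set z := y * m / q.
have z0 : 0 < z by apply: Rdiv_lt_0_compat => //; apply: Rmult_lt_0_compat.
have zq : z * q = y * m by rewrite /z; field; lra.
have -> : ln (m / q) = ln (/ y) + ln z.
  rewrite -ln_mult //; last exact: Rinv_0_lt_compat.
  by congr ln; rewrite /z; field; lra.
have l1 := ln_le_sub1 z0.
case: e he => [/(_ isT) he|_] /=; last first.
  have := Rmult_le_compat_l q _ _ q0 l1; nra.
have z4 : 4 <= z by nra.
have l2 : ln z <= 3 / 4 * z - 1.
  have -> : ln z = ln (z / 2) + ln 2 by rewrite -ln_mult; [congr ln; lra|lra|lra].
  have := ln_le_sub1 (z := z / 2); have := ln_le_sub1 (z := 2); lra.
have := Rmult_le_compat_l q _ _ q0 l2; nra.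
Qed.

(** A log-sum inequality with a gain: [entropy_piece] is applied to both parts with the same ratio
    [y = Q / M]. Since [y * M = Q], the linear terms cancel in the sum and only the gain of the
    first part remains. *)
Lemma entropy_split q1 q2 m1 m2 (e : bool) :
  0 <= q1 <= m1 -> 0 <= q2 <= m2 -> 0 < m1 + m2 ->
  (e -> 4 * q1 * (m1 + m2) <= (q1 + q2) * m1) ->
  q1 * ln (m1 / q1) + q2 * ln (m2 / q2)
    + ind e * (q1 + q2) * (m1 / (m1 + m2) / 4)
  <= (q1 + q2) * ln ((m1 + m2) / (q1 + q2)).
Proof.
move=> h1 h2 m0 he; set M := m1 + m2 in m0 he *; set Q := q1 + q2 in he *.
have Q0 : 0 <= Q by rewrite /Q; lra.
case: (Rle_lt_or_eq_dec _ _ Q0) => [Qgt|Qe]; last first.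
  have -> : q1 = 0 by move: Qe; rewrite /Q; lra.
  have -> : q2 = 0 by move: Qe; rewrite /Q; lra.
  by rewrite -Qe; lra.
have y0 : 0 < Q / M by apply: Rdiv_lt_0_compat.
have yM : Q / M * M = Q by field; lra.
have -> : M / Q = / (Q / M) by field; lra.
have he' : e -> 4 * q1 <= Q / M * m1.
  move=> /he h; apply: (Rmult_le_reg_r M) => //.
  by have -> : Q / M * m1 * M = Q * m1 by field; lra.
have p1 := entropy_piece h1 y0 he'.
have p2 := @entropy_piece q2 m2 (Q / M) false h2 y0 (fun h => False_ind _ (notF h)).
have -> : ind e * Q * (m1 / M / 4) = ind e * (Q / M * m1 / 4) by field; lra.
set l := ln (/ (Q / M)) in p1 p2 *; set y := Q / M in p1 p2 yM *.
have -> : Q * l = q1 * l + q2 * l by rewrite /Q; ring.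
have yM' : y * m1 + y * m2 = q1 + q2 by rewrite -Rmult_plus_distr_l.
by rewrite /= in p2; lra.
Qed.

(** If a 0-rectangle [Q] loses less than a factor of 4 both in the rows and in the columns of [S],
    the two failures multiply and bound its mass in [v] by its mass in [meet v S]. *)
Lemma cross_mul x xS xSQ x0 y yS ySQ y0 :
  0 <= x * xS -> 0 <= y * yS ->
  x * xS <= 4 * xSQ * x0 -> y * yS <= 4 * ySQ * y0 ->
  x * y * (xS * yS) <= 16 * (x0 * y0) * (xSQ * ySQ).
Proof.
move=> x_ge0 y_ge0 hx hy.
by have := Rmult_le_compat _ _ _ _ x_ge0 y_ge0 hx hy; lra.
Qed.

Lemma scale_row x1 x0 x xS yQ y : 0 <= yQ -> 0 <= y ->
  4 * x1 * x0 <= x * xS -> 4 * (x1 * yQ) * (x0 * y) <= x * yQ * (xS * y).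
Proof.
move=> yQ0 y0 h.
by have := Rmult_le_compat_r _ _ _ (Rmult_le_pos _ _ yQ0 y0) h; lra.
Qed.

Lemma scale_col y1 y0 y yS xQ x : 0 <= xQ -> 0 <= x ->
  4 * y1 * y0 <= y * yS -> 4 * (xQ * y1) * (x * y0) <= xQ * y * (x * yS).
Proof.
move=> xQ0 x0 h.
by have := Rmult_le_compat_r _ _ _ (Rmult_le_pos _ _ xQ0 x0) h; lra.
Qed.

(** * Mass and integrals under a product weight *)

Section Rectangles.
Variables (X Y : finType) (a : X -> R) (b : Y -> R).
Hypotheses (a_ge0 : forall x, 0 <= a x) (b_ge0 : forall y, 0 <= b y).
Implicit Types (D : pred (X * Y)) (g h : X * Y -> R) (v S : rect X Y).

Definition inrect v : pred (X * Y) := fun p => in_rect v p.1 p.2.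
Definition meet v S : rect X Y := (v.1 :&: S.1, v.2 :&: S.2).

Definition integral D g : R := tsum (fun p => ind (D p) * (a p.1 * b p.2 * g p)).

Definition mass v : R := integral (inrect v) (fun _ => 1).
Definition massX (A : {set X}) : R := tsum (fun x => ind (x \in A) * a x).
Definition massY (B : {set Y}) : R := tsum (fun y => ind (y \in B) * b y).

Lemma ab_ge0 p : 0 <= a p.1 * b p.2.
Proof. exact: Rmult_le_pos. Qed.

Lemma integral_ge0 D g : (forall p, D p -> 0 <= g p) -> 0 <= integral D g.
Proof.
move=> g0; apply: tsum_ge0 => p; case: (boolP (D p)) => Dp /=; last lra.
by have := Rmult_le_pos _ _ (ab_ge0 p) (g0 p Dp); lra.
Qed.

Lemma eq_int D D' g h : D =1 D' -> (forall p, D p -> g p = h p) ->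
  integral D g = integral D' h.
Proof.
move=> DD gh; apply: eq_tsum => p; rewrite -DD.
by case: (boolP (D p)) => Dp /=; [rewrite gh | lra].
Qed.

Lemma ler_int D g h : (forall p, D p -> g p <= h p) -> integral D g <= integral D h.
Proof.
move=> gh; apply: ler_tsum => p; case: (boolP (D p)) => Dp /=; last lra.
by have := Rmult_le_compat_l _ _ _ (ab_ge0 p) (gh p Dp); lra.
Qed.

Lemma ler_int_sub D D' g : (forall p, D p -> D' p) ->
  (forall p, 0 <= g p) -> integral D g <= integral D' g.
Proof.
move=> DD g0; apply: ler_tsum => p.
have h : 0 <= a p.1 * b p.2 * g p by apply: Rmult_le_pos => //; exact: ab_ge0.
case: (boolP (D p)) => [/DD ->|_] /=; first lra.
by case: (D' p) => /=; lra.
Qed.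

Lemma intD D g h : integral D (fun p => g p + h p) = integral D g + integral D h.
Proof. by rewrite /integral -tsumD; apply: eq_tsum => p; ring. Qed.

Lemma intZ D c g : integral D (fun p => c * g p) = c * integral D g.
Proof. by rewrite /integral -tsumZ; apply: eq_tsum => p; ring. Qed.

Lemma integral_split D D' g :
  integral D g = integral (fun p => D p && D' p) g + integral (fun p => D p && ~~ D' p) g.
Proof.
rewrite /integral -tsumD; apply: eq_tsum => p.
by case: (D p); case: (D' p) => /=; ring.
Qed.

Lemma mass_ge0 v : 0 <= mass v.
Proof. by apply: integral_ge0 => p _; lra. Qed.

Lemma mass_le_sub v v' : (forall p, inrect v p -> inrect v' p) -> mass v <= mass v'.
Proof. by move=> h; apply: ler_int_sub => // p; lra. Qed.

(** Fubini for the product weight; it lets [split_rect] treat row and column densities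
    separately. *)
Lemma mass_prod v : mass v = massX v.1 * massY v.2.
Proof.
rewrite /massX -tsumZr.
rewrite (eq_tsum (G := fun x => tsum (fun y =>
  ind (x \in v.1) * a x * (ind (y \in v.2) * b y)))); last by move=> x; rewrite tsumZ.
rewrite -tsum_pair; apply: eq_tsum => p.
by rewrite /inrect /in_rect ind_and; ring.
Qed.

Lemma massX_ge0 A : 0 <= massX A.
Proof. by apply: tsum_ge0 => x; apply: Rmult_le_pos; [exact: ind_ge0|]. Qed.

Lemma massY_ge0 A : 0 <= massY A.
Proof. by apply: tsum_ge0 => x; apply: Rmult_le_pos; [exact: ind_ge0|]. Qed.

Lemma inrect_meet v S p : inrect (meet v S) p = inrect v p && inrect S p.
Proof. by rewrite /inrect /in_rect !inE /=; do !case: (_ \in _). Qed.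

Lemma integral_cover (w : rect X Y -> R) v g :
  integral (inrect v) (fun p => g p * Defs.cover w p.1 p.2)
  = tsum (fun S => w S * integral (inrect (meet v S)) g).
Proof.
rewrite (eq_tsum (G := fun S => tsum (fun p =>
  w S * (ind (inrect (meet v S) p) * (a p.1 * b p.2 * g p))))); last first.
  by move=> S; rewrite tsumZ.
rewrite exchange_tsum; apply: eq_tsum => p.
rewrite /Defs.cover rsumE -!Rmult_assoc -tsumZ; apply: eq_tsum => S.
by rewrite inrect_meet ind_and /inrect; ring.
Qed.

Lemma integral_cover1 (w : rect X Y -> R) v :
  integral (inrect v) (fun p => Defs.cover w p.1 p.2) = tsum (fun S => w S * mass (meet v S)).
Proof.
by rewrite -integral_cover; apply: eq_int => // p _; rewrite Rmult_1_l.
Qed.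

Lemma mass_meet_le v S : 0 <= mass (meet v S) <= mass v.
Proof.
split; first exact: mass_ge0.
by apply: mass_le_sub => p; rewrite inrect_meet => /andP[].
Qed.

(** With indicators, additivity of every integral is plain linearity, and the relation passes to
    intersections. *)
Definition splits v v1 v2 : Prop :=
  forall p, ind (inrect v p) = ind (inrect v1 p) + ind (inrect v2 p).

Lemma splits_int v v1 v2 g : splits v v1 v2 ->
  integral (inrect v) g = integral (inrect v1) g + integral (inrect v2) g.
Proof.
by move=> h; rewrite /integral -tsumD; apply: eq_tsum => p; rewrite h; ring.
Qed.

Lemma splits_meet v v1 v2 S : splits v v1 v2 ->
  splits (meet v S) (meet v1 S) (meet v2 S).
Proof. by move=> h p; rewrite !inrect_meet 3!(ind_and (inrect _ p)) h; ring. Qed.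

Lemma splits_row v A : splits v (v.1 :&: A, v.2) (v.1 :\: A, v.2).
Proof.
move=> p; rewrite /inrect /in_rect !inE /=.
by case: (_ \in A); case: (_ \in v.1); case: (_ \in v.2) => /=; ring.
Qed.

Lemma splits_col v B : splits v (v.1, v.2 :&: B) (v.1, v.2 :\: B).
Proof.
move=> p; rewrite /inrect /in_rect !inE /=.
by case: (_ \in B); case: (_ \in v.1); case: (_ \in v.2) => /=; ring.
Qed.

(** * The entropy potential *)

Section Potential.
Variable U : rect X Y -> R.
Hypothesis U_ge0 : forall S, 0 <= U S.

(** When [meet v S] has mass 0, the outer factor makes the term 0, whatever the quotient and [ln]
    return. *)
Definition pot v : R :=
  tsum (fun S => U S * (mass (meet v S) * ln (mass v / mass (meet v S)))).

Lemma pot_ge0 v : 0 <= pot v.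
Proof.
apply: tsum_ge0 => S; apply: Rmult_le_pos => //.
have [q0 qm] := mass_meet_le v S.
case: (Rle_lt_or_eq_dec _ _ q0) => [qgt|<-]; last lra.
apply: Rmult_le_pos => //; rewrite -ln_1.
have z1 : 1 <= mass v / mass (meet v S).
  by apply: (Rmult_le_reg_r (mass (meet v S))) => //; field_simplify; lra.
case: (Rle_lt_or_eq_dec _ _ z1) => [z1'|<-]; last lra.
by left; apply: ln_increasing; lra.
Qed.

(** Sum of [entropy_split] over all [S]. A rectangle in [E] gains its weighted mass times
    [mass v1 / mass v / 4]; as [E] carries at least [mass v / 40], the total gain is at least
    [mass v1 / 160]. *)
Lemma pot_split v v1 v2 (E : pred (rect X Y)) :
  splits v v1 v2 -> 0 < mass v ->
  (forall S, E S -> 4 * mass (meet v1 S) * mass v <= mass (meet v S) * mass v1) ->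
  mass v / 40 <= tsum (fun S => ind (E S) * (U S * mass (meet v S))) ->
  pot v1 + pot v2 + mass v1 / 160 <= pot v.
Proof.
move=> sp m0 hE big.
have mE : mass v = mass v1 + mass v2 by exact: splits_int.
have h : forall S,
    U S * (mass (meet v1 S) * ln (mass v1 / mass (meet v1 S)))
    + U S * (mass (meet v2 S) * ln (mass v2 / mass (meet v2 S)))
    + ind (E S) * (U S * mass (meet v S)) * (mass v1 / mass v / 4)
  <= U S * (mass (meet v S) * ln (mass v / mass (meet v S))).
  move=> S.
  have qE : mass (meet v S) = mass (meet v1 S) + mass (meet v2 S).
    exact/splits_int/splits_meet.
  have := @entropy_split _ _ _ _ (E S) (mass_meet_le v1 S) (mass_meet_le v2 S).
  rewrite -mE -qE => /(_ m0 (@hE S)) /(Rmult_le_compat_l _ _ _ (U_ge0 S)).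
  by lra.
have := ler_tsum h; rewrite !tsumD tsumZr -/(pot v1) -/(pot v2) -/(pot v).
have c0 : 0 <= mass v1 / mass v / 4.
  have := mass_ge0 v1; have := Rinv_0_lt_compat _ m0 => i1 i2.
  by have := Rmult_le_pos _ _ i2 (Rlt_le _ _ i1); rewrite /Rdiv; lra.
have := Rmult_le_compat_r _ _ _ c0 big.
have -> : mass v / 40 * (mass v1 / mass v / 4) = mass v1 / 160 by field; lra.
by lra.
Qed.

(** Termwise [q ln (1 / q) <= q ln W + 1 / W], from [ln z <= z - 1] at [z = 1 / (W q)]. After
    weighting, the first terms sum to at most [ln W] and the second to at most 1. *)
Lemma pot_le v W : mass v = 1 -> 1 <= W -> tsum U <= W ->
  integral (inrect v) (fun p => Defs.cover U p.1 p.2) <= 1 -> pot v <= ln W + 1.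
Proof.
move=> v1 W1 UW; rewrite integral_cover1 => c1.
have lnW : 0 <= ln W.
  rewrite -ln_1; case: (Rle_lt_or_eq_dec _ _ W1) => [w|<-]; last lra.
  by left; apply: ln_increasing; lra.
have h : forall S, U S * (mass (meet v S) * ln (mass v / mass (meet v S)))
    <= ln W * (U S * mass (meet v S)) + / W * U S.
  move=> S; rewrite v1; have [q0 _] := mass_meet_le v S.
  set q := mass _ in q0 *.
  have iW : 0 < / W by apply: Rinv_0_lt_compat; lra.
  suff : q * ln (1 / q) <= ln W * q + / W.
    by move=> /(Rmult_le_compat_l _ _ _ (U_ge0 S)); lra.
  case: (Rle_lt_or_eq_dec _ _ q0) => [qgt|<-]; last lra.
  have z0 : 0 < / (W * q) by apply: Rinv_0_lt_compat; nra.
  have -> : ln (1 / q) = ln W + ln (/ (W * q)).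
    by rewrite -ln_mult //; [congr ln; field; lra | lra].
  have := Rmult_le_compat_l _ _ _ q0 (ln_le_sub1 z0).
  have -> : q * (/ (W * q) - 1) = / W - q by field; lra.
  by lra.
have := ler_tsum h; rewrite -/(pot v) tsumD !tsumZ => /Rle_trans; apply.
have := Rmult_le_compat_l _ _ _ lnW c1.
have iW : 0 <= / W by left; apply: Rinv_0_lt_compat; lra.
have := Rmult_le_compat_l _ _ _ iW UW; rewrite Rinv_l; lra.
Qed.

End Potential.

(** * Protocols built from the two covers *)

Section Protocols.
Variables (f : X -> Y -> bool) (w : bool -> rect X Y -> R) (W : R).
Hypotheses (w_ge0 : forall z S, 0 <= w z S).
Hypotheses (W_ge1 : 1 <= W) (w_le : tsum (w true) <= W).
Hypothesis cover_le1 : forall z x y, Defs.cover (w z) x y <= 1.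
Hypothesis cover_conflict : forall x y,
  Defs.cover (w false) x y * Defs.cover (w true) x y <= 1 / 6400.

Local Notation cov z := (fun p : X * Y => Defs.cover (w z) p.1 p.2).
Local Notation pot0 := (pot (w false)).

Lemma cover_ge0 z x y : 0 <= Defs.cover (w z) x y.
Proof.
rewrite /Defs.cover rsumE; apply: tsum_ge0 => S.
by apply: Rmult_le_pos; [exact: ind_ge0|].
Qed.

(** Averaging over the 1-cover: if every [S] failed, the sum with weights [w true] would be at most
    [mass v / 20] from the size term, as the total weight is at most [W], plus [320 / 6400 = 1 / 20]
    of [mass v] from the conflict bound. This contradicts the assumed 1/10. *)
Lemma large_pure_rect v : mass v / 10 < integral (inrect v) (cov true) ->
  exists S, mass v / (20 * W) + 320 * integral (inrect (meet v S)) (cov false)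
            <= mass (meet v S).
Proof.
move=> big; apply: NNPP => /not_ex_all_not none.
have h : forall S, w true S * mass (meet v S) <=
    w true S * (mass v / (20 * W))
    + 320 * (w true S * integral (inrect (meet v S)) (cov false)).
  move=> S; have /Rnot_le_lt/Rlt_le := none S.
  by move=> /(Rmult_le_compat_l _ _ _ (w_ge0 true S)); lra.
have := ler_tsum h; rewrite tsumD tsumZr tsumZ -integral_cover -integral_cover1.
have : integral (inrect v) (fun p => cov false p * cov true p) <= 1 / 6400 * mass v.
  rewrite -intZ; apply: ler_int => p _ /=.
  by have := cover_conflict p.1 p.2; lra.
have : tsum (w true) * (mass v / (20 * W)) <= mass v / 20.
  have -> : mass v / 20 = W * (mass v / (20 * W)) by field; lra.
  apply: Rmult_le_compat_r => //; apply: Rmult_le_pos; first exact: mass_ge0.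
  by left; apply: Rinv_0_lt_compat; lra.
by move: big => /=; lra.
Qed.

(* A pure rectangle [S] meets the 0-rectangles in little mass, and mass is a
   product; hence most 0-rectangles shrink either in the rows or in the columns
   of [S], and splitting [v] along that side lowers the potential. *)
Lemma split_rect v :
  mass v / 10 < integral (inrect v) (cov false) ->
  mass v / 10 < integral (inrect v) (cov true) ->
  exists v1 v2, [/\ splits v v1 v2, mass v / (20 * W) <= mass v1
    & pot0 v1 + pot0 v2 + mass v1 / 160 <= pot0 v].
Proof.
move=> big0 big1.
have m0 : 0 < mass v.
  have : integral (inrect v) (cov true) <= mass v by apply: ler_int => p _ /=.
  by lra.
have [S hS] := large_pure_rect big1.
have c0 : 0 <= integral (inrect (meet v S)) (cov false).
  by apply: integral_ge0 => p _; exact: cover_ge0.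
have r0 : 0 < mass (meet v S).
  apply: Rlt_le_trans hS; apply: Rplus_lt_le_0_compat; last lra.
  by apply: Rdiv_lt_0_compat; lra.
set v1 := (v.1 :&: S.1, v.2); set v2 := (v.1, v.2 :&: S.2).
have mS := mass_prod (meet v S); have mv := mass_prod v.
rewrite /= in mS.
(* [EA] and [EB]: the density of [Q] drops by a factor of 4 on passing from [v] to the rows,
   respectively columns, of [S]. *)
pose EA (Q : rect X Y) : bool :=
  Rle_dec (4 * massX (v.1 :&: S.1 :&: Q.1) * massX v.1)
          (massX (v.1 :&: Q.1) * massX (v.1 :&: S.1)).
pose EB (Q : rect X Y) : bool :=
  Rle_dec (4 * massY (v.2 :&: S.2 :&: Q.2) * massY v.2)
          (massY (v.2 :&: Q.2) * massY (v.2 :&: S.2)).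
(* A [Q] in neither class is charged to its mass inside [meet v S], by [cross_mul]. *)
have key : forall Q, w false Q * mass (meet v Q) <=
    ind (EA Q) * (w false Q * mass (meet v Q))
    + ind (EB Q) * (w false Q * mass (meet v Q))
    + 16 * mass v / mass (meet v S) * (w false Q * mass (meet (meet v S) Q)).
  move=> Q; have wq := w_ge0 false Q.
  have p1 : 0 <= w false Q * mass (meet v Q).
    by apply: Rmult_le_pos => //; exact: mass_ge0.
  have p2 : 0 <= 16 * mass v / mass (meet v S) * (w false Q * mass (meet (meet v S) Q)).
    apply: Rmult_le_pos; first by apply: Rlt_le; apply: Rdiv_lt_0_compat; lra.
    by apply: Rmult_le_pos => //; exact: mass_ge0.
  rewrite /EA /EB; case: Rle_dec => [?|/Rnot_le_lt nA] /=.
    by case: Rle_dec => ? /=; lra.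
  case: Rle_dec => [?|/Rnot_le_lt nB] /=; first lra.
  have -> : 16 * mass v / mass (meet v S) * (w false Q * mass (meet (meet v S) Q))
    = w false Q * (16 * mass v / mass (meet v S) * mass (meet (meet v S) Q)) by ring.
  suff : mass (meet v Q) <= 16 * mass v / mass (meet v S) * mass (meet (meet v S) Q).
    by move=> /(Rmult_le_compat_l _ _ _ wq); lra.
  apply: (Rmult_le_reg_r (mass (meet v S))) => //.
  have -> : 16 * mass v / mass (meet v S) * mass (meet (meet v S) Q) * mass (meet v S)
     = 16 * mass v * mass (meet (meet v S) Q) by field; lra.
  rewrite mS mv !mass_prod /=.
  by apply: cross_mul (Rlt_le _ _ nA) (Rlt_le _ _ nB); apply: Rmult_le_pos;
    (exact: massX_ge0 || exact: massY_ge0).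
have := ler_tsum key; rewrite !tsumD tsumZ -!integral_cover1.
(* By the choice of [S] the charged part is at most [16 / 320 = 1 / 20] of [mass v]. The 0-cover has
   more than [mass v / 10], so [EA] or [EB] keeps at least [mass v / 40]. *)
have : 16 * mass v / mass (meet v S) * integral (inrect (meet v S)) (cov false) <= mass v / 20.
  apply: (Rmult_le_reg_r (mass (meet v S))) => //.
  have -> : 16 * mass v / mass (meet v S) * integral (inrect (meet v S)) (cov false)
    * mass (meet v S) = mass v * (16 * integral (inrect (meet v S)) (cov false)) by field; lra.
  have -> : mass v / 20 * mass (meet v S) = mass v * (mass (meet v S) / 20) by field.
  apply: Rmult_le_compat_l; first lra.
  have : 0 <= mass v / (20 * W) by apply: Rlt_le; apply: Rdiv_lt_0_compat; lra.
  by lra.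
set sA := tsum _; set sB := tsum _ => small total.
have [hA|hB] : mass v / 40 <= sA \/ mass v / 40 <= sB.
- by case: (Rle_dec (mass v / 40) sA) => ?; [left | right; lra].
- exists v1, (v.1 :\: S.1, v.2); split; first exact: splits_row.
    apply: (@Rle_trans _ (mass (meet v S))); first lra.
    by apply: mass_le_sub => p; rewrite /inrect /in_rect !inE => /andP[-> /andP[->]].
  apply: (@pot_split _ (w_ge0 false) _ _ _ EA) => //; first exact: splits_row.
  move=> Q; rewrite /EA; case: Rle_dec => //= h _; rewrite !mass_prod /=.
  by apply: scale_row h; exact: massY_ge0.
- exists v2, (v.1, v.2 :\: S.2); split; first exact: splits_col.
    apply: (@Rle_trans _ (mass (meet v S))); first lra.
    by apply: mass_le_sub => p; rewrite /inrect /in_rect !inE => /andP[/andP[-> _] ->].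
  apply: (@pot_split _ (w_ge0 false) _ _ _ EB) => //; first exact: splits_col.
  move=> Q; rewrite /EB; case: Rle_dec => //= h _; rewrite !mass_prod /=.
  by apply: scale_col h; exact: massX_ge0.
Qed.

Definition err D (P : protocol X Y) : R :=
  integral D (fun p => ind (run P p.1 p.2 != f p.1 p.2)).

Definition deficit v : R := integral (inrect v) (fun p => 1 - cov (f p.1 p.2) p).

Lemma deficit_ge0 v : 0 <= deficit v.
Proof. by apply: integral_ge0 => p _; have := cover_le1 (f p.1 p.2) p.1 p.2; lra. Qed.

(** The leaf errs exactly where [f] is [z]; there 1 is the value of the [z]-cover plus what that
    cover misses. *)
Lemma err_leaf v z : err (inrect v) (Leaf X Y (~~ z))
  <= integral (inrect v) (cov z) + deficit v.
Proof.
rewrite -intD; apply: ler_int => p _ /=.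
have := cover_le1 (f p.1 p.2) p.1 p.2; have := cover_ge0 z p.1 p.2.
by case: (f p.1 p.2); case: z => /=; lra.
Qed.

Lemma err_le_mass v P : err (inrect v) P <= mass v.
Proof. by apply: ler_int => p _; case: (_ != _) => /=; lra. Qed.

(** The error allowed on [v]: density [c], plus the uncovered mass, plus a credit at rate [s] for
    potential not yet spent. *)
Definition budget c s v : R := c * mass v + deficit v + s * pot0 v.

Lemma budget_ge0 c s v : 0 <= c -> 0 <= s -> 0 <= budget c s v.
Proof.
move=> c0 s0.
have := Rmult_le_pos _ _ c0 (mass_ge0 v).
have := Rmult_le_pos _ _ s0 (pot_ge0 (w_ge0 false) v).
by have := deficit_ge0 v; rewrite /budget; lra.
Qed.

(** The remainder of a chain that ends in a leaf. *)
Definition rect0 : rect X Y := (set0, set0).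

Lemma inrect0 p : inrect rect0 p = false.
Proof. by rewrite /inrect /in_rect !inE. Qed.

Lemma integral0 g : integral (inrect rect0) g = 0.
Proof.
rewrite (eq_int (D' := pred0) (h := fun _ => 0 * 0)) ?intZ; first ring.
  by move=> p; rewrite inrect0.
by move=> p; rewrite inrect0.
Qed.

Lemma budget0 c s : budget c s rect0 = 0.
Proof.
rewrite /budget /mass /deficit !integral0.
have -> : pot0 rect0 = 0; last by ring.
rewrite /pot (eq_tsum (G := fun _ => 0 * 0)) ?tsumZ; first ring.
move=> S; have -> : mass (meet rect0 S) = 0; last by ring.
by rewrite -[RHS](integral0 (fun _ => 1)) /mass /meet /rect0 /= !set0I.
Qed.

Lemma splits_sub v v1 v2 p : splits v v1 v2 -> inrect v2 p -> inrect v p.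
Proof.
move=> /(_ p); case: (inrect v p); case: (inrect v1 p); case: (inrect v2 p) => //= h;
  by exfalso; lra.
Qed.

Lemma splits_diff v v1 v2 p : splits v v1 v2 -> inrect v p && ~~ inrect v2 p = inrect v1 p.
Proof.
move=> /(_ p); case: (inrect v p); case: (inrect v1 p); case: (inrect v2 p) => //= h;
  by exfalso; lra.
Qed.

Definition membership_protocol v (P1 P0 : protocol X Y) : protocol X Y :=
  AliceNode (fun x => x \in v.1) P0 (BobNode (fun y => y \in v.2) P0 P1).

Lemma run_membership v P1 P0 p : run (membership_protocol v P1 P0) p.1 p.2
  = if inrect v p then run P1 p.1 p.2 else run P0 p.1 p.2.
Proof. by rewrite /inrect /in_rect /=; case: (_ \in _); case: (_ \in _). Qed.

Section Phase.
Variables (c s : R) (d : nat).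
Hypotheses (c_ge : 1 / 10 <= c) (s_ge0 : 0 <= s).
(** The constant may be worse by [s / 160]: a split lowers the potential by [mass v1 / 160], which
    pays for this on [v1]. *)
Hypothesis IH : forall v, exists P : protocol X Y,
  (depth P <= d)%N /\ err (inrect v) P <= budget (c + s / 160) s v.

(* [v'] is what remains of [v] after [2 ^ L] successive splits along which the
   input always fell in the second part; locating the input in the resulting
   chain by binary search costs two bits per level. *)
Lemma chain_protocol L v : exists v' (P : protocol X Y),
  [/\ forall p, inrect v' p -> inrect v p, (depth P <= d + 2 * L)%N,
      mass v' <= (1 - / (20 * W)) ^ (expn 2 L) * mass v
    & err (fun p => inrect v p && ~~ inrect v' p) P <= budget c s v - budget c s v'].
Proof.
have r0 : 0 <= 1 - / (20 * W).
  have : / (20 * W) <= / 1 by apply: Rinv_le_contravar; lra.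
  by rewrite Rinv_1; lra.
elim: L v => [|L IHL] v; last first.
  have [v1 [P1 [s1 d1 m1 e1]]] := IHL v.
  have [v2 [P2 [s2 d2 m2 e2]]] := IHL v1.
  exists v2, (membership_protocol v1 P2 P1); split.
  - by move=> p /s2/s1.
  - rewrite /= (_ : d + 2 * L.+1 = (d + 2 * L).+2)%N; last by rewrite mulnS addnCA.
    by rewrite ltnS geq_max ltnS geq_max d1 d2 leqW.
  - rewrite expnS mul2n -addnn pow_add Rmult_assoc.
    apply: (Rle_trans _ _ _ m2); apply: Rmult_le_compat_l => //.
    exact: pow_le.
  (* Outside [v1] the first half answers, between [v1] and [v2] the second half; the two budget
     differences telescope. *)
  - rewrite /err (integral_split _ (inrect v1)).
    set i1 := integral _ _; set i2 := integral _ _.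
    have -> : i1 = err (fun p => inrect v1 p && ~~ inrect v2 p) P2.
      apply: eq_int => p; last by rewrite run_membership => /andP[_ ->].
      by case: (boolP (inrect v1 p)) => [/s1 ->|_]; rewrite ?andbF ?andbT.
    have -> : i2 = err (fun p => inrect v p && ~~ inrect v1 p) P1.
      apply: eq_int => p; last by rewrite run_membership => /andP[_ /negbTE ->].
      by case: (boolP (inrect v2 p)) => [/s2 ->|_]; rewrite ?andbF ?andbT.
    by lra.
(* If one cover is small on [v], the opposite constant answers on all of [v] and nothing remains.
   Its error [mass v / 10 + deficit v] fits because [1 / 10 <= c]. *)
have leaf : forall z, integral (inrect v) (cov z) <= mass v / 10 ->
    exists v' (P : protocol X Y),
    [/\ forall p, inrect v' p -> inrect v p, (depth P <= d + 2 * 0)%N,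
        mass v' <= (1 - / (20 * W)) ^ (expn 2 0) * mass v
      & err (fun p => inrect v p && ~~ inrect v' p) P <= budget c s v - budget c s v'].
  move=> z hz; exists rect0, (Leaf X Y (~~ z)); split => //.
  - by move=> p; rewrite inrect0.
  - rewrite /mass integral0; apply: Rmult_le_pos; first exact: pow_le.
    exact: mass_ge0.
  - rewrite budget0 (_ : err _ _ = err (inrect v) (Leaf X Y (~~ z))); last first.
      by apply: eq_int => // p; rewrite inrect0 andbT.
    have := err_leaf v z; have := Rmult_le_compat_r _ _ _ (mass_ge0 v) c_ge.
    have := Rmult_le_pos _ _ s_ge0 (pot_ge0 (w_ge0 false) v).
    by rewrite /budget; lra.
case: (Rle_dec (integral (inrect v) (cov false)) (mass v / 10)) => [/leaf //|/Rnot_le_lt b0].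
case: (Rle_dec (integral (inrect v) (cov true)) (mass v / 10)) => [/leaf //|/Rnot_le_lt b1].
have [v1 [v2 [sp m1 hp]]] := split_rect b0 b1.
have [P [dP eP]] := IH v1.
have mE : mass v = mass v1 + mass v2 by exact: splits_int.
exists v2, P; split.
- by move=> p; exact: splits_sub.
- by rewrite muln0 addn0.
- by rewrite expn0 pow_1 mE; move: m1; rewrite mE /Rdiv; lra.
- rewrite (_ : err _ _ = err (inrect v1) P); last first.
    by apply: eq_int => // p; exact: splits_diff.
  have dE : deficit v = deficit v1 + deficit v2 by exact: splits_int.
  move: eP; rewrite /budget mE dE.
  by have := Rmult_le_compat_l _ _ _ s_ge0 hp; lra.
Qed.

(** On the remainder [v'] any answer will do: the error is at most [mass v'], hence at most
    [eta * mass v], and the budget of [v'] is nonnegative. *)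
Lemma phase_protocol L eta v : (1 - / (20 * W)) ^ (expn 2 L) <= eta ->
  exists P : protocol X Y,
  (depth P <= d + 2 * L)%N /\ err (inrect v) P <= budget (c + eta) s v.
Proof.
move=> hL; have [v' [P [sv dP mv eP]]] := chain_protocol L v.
exists P; split => //; rewrite /err (integral_split _ (inrect v')).
have -> : integral (fun p => inrect v p && inrect v' p)
    (fun p => ind (run P p.1 p.2 != f p.1 p.2)) = err (inrect v') P.
  by apply: eq_int => // p; case: (boolP (inrect v' p)) => [/sv ->|_]; rewrite ?andbF.
have := err_le_mass v' P; have := Rmult_le_compat_r _ _ _ (mass_ge0 v) hL.
have : 0 <= budget c s v' by apply: budget_ge0; lra.
by move: eP; rewrite /err /budget; lra.
Qed.

End Phase.

(** Induction on the number of phases, each new one placed at the root. With [s = 160 / N] a phase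
    lowers the constant by [s / 160 = 1 / N] and gives back [eta = 1 / (4 N)], a net [3 / (4 N)]. *)
Lemma iterated_protocol N L T v : (2 <= N)%N -> (T <= N)%N ->
  (1 - / (20 * W)) ^ (expn 2 L) <= / (4 * INR N) ->
  exists P : protocol X Y, (depth P <= T * (2 * L))%N /\
    err (inrect v) P <= budget (1 - INR T * (3 / (4 * INR N))) (160 / INR N) v.
Proof.
move=> N2 TN hL.
have N2' : 2 <= INR N by have := le_INR _ _ (leP N2); rewrite /=; lra.
have iN : 0 < / INR N by apply: Rinv_0_lt_compat; lra.
have s0 : 0 <= 160 / INR N by rewrite /Rdiv; lra.
elim: T TN v => [|T IHT] TN v.
  exists (Leaf X Y true); split => //=; rewrite /budget.
  have := err_le_mass v (Leaf X Y true).
  have := Rmult_le_pos _ _ s0 (pot_ge0 (w_ge0 false) v).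
  by have := deficit_ge0 v; lra.
pose c := 1 - INR T * (3 / (4 * INR N)) - / INR N.
(* From [T + 1 <= N] and [2 <= N] one even gets [c >= 1 / 8]. *)
have c10 : 1 / 10 <= c.
  have : INR T + 1 <= INR N by rewrite -S_INR; exact/le_INR/leP.
  move=> /(Rmult_le_compat_r _ _ _ (Rlt_le _ _ iN)); rewrite Rinv_r; last lra.
  have : INR N * / INR N = 1 by rewrite Rinv_r; lra.
  rewrite /c (_ : 3 / (4 * INR N) = 3 / 4 * / INR N); last by field; lra.
  nra.
have IH : forall u, exists P : protocol X Y, (depth P <= T * (2 * L))%N /\
    err (inrect u) P <= budget (c + 160 / INR N / 160) (160 / INR N) u.
  move=> u; rewrite (_ : c + _ = 1 - INR T * (3 / (4 * INR N))); last first.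
    by rewrite /c; field; lra.
  by apply: IHT; exact: ltnW.
have [P [dP eP]] := phase_protocol c10 s0 IH v hL.
exists P; split; first by rewrite mulSn addnC.
move: eP; rewrite (_ : c + _ = 1 - INR T.+1 * (3 / (4 * INR N))) // S_INR /c.
by field; lra.
Qed.
End Protocols.
End Rectangles.

(** * Least communication cost and values of the linear programs *)

Lemma tsum_single (T : finType) (F : T -> R) j :
  (forall i, i != j -> F i = 0) -> tsum F = F j.
Proof.
move=> F0; rewrite /rsum (bigD1 j) //= big1; first lra.
by move=> i ij; rewrite F0.
Qed.

(** [CC] is picked by [epsilon], so a least depth must be shown to exist; descent from the depth of
    [P] finds one. *)
Lemma CC_le (X Y : finType) (mu : X -> Y -> R) f eps (P : protocol X Y) :
  error mu f P <= eps -> (CC mu eps f <= depth P)%N.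
Proof.
move=> eP; set Q := fun d => (exists p, depth p = d /\ error mu f p <= eps) /\
              (forall p, error mu f p <= eps -> (d <= depth p)%N).
suff : exists d, Q d by move=> /(epsilon_spec (inhabits 0%nat)) [_]; apply.
move: {2}(depth P).+1 (ltnSn (depth P)) => d; elim: d P eP => // d IHd P eP.
rewrite ltnS => dP; have [[P' [eP' lt]]|no] :=
  classic (exists P', error mu f P' <= eps /\ (depth P' < depth P)%N).
  by apply: IHd eP' _; apply: leq_trans lt dP.
exists (depth P); split; first by exists P.
by move=> P' eP'; rewrite leqNgt; apply/negP => lt; apply: no; exists P'.
Qed.

Section SmoothRectangleBound.
Variables (X Y : finType) (mu : X -> Y -> R) (f : X -> Y -> bool) (z : bool).
Variables (eps delta : R).
Hypothesis mu_ge0 : forall x y, 0 <= mu x y.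
Hypotheses (eps_ge0 : 0 <= eps) (delta_ge0 : 0 <= delta).

(** Weight 1 on each singleton rectangle of the fiber over [z]: a feasible solution, so the infimum
    is over a nonempty set. *)
Definition point_weight (S : rect X Y) : R :=
  ind [exists p : X * Y, (S == ([set p.1], [set p.2])) && (f p.1 p.2 == z)].

Lemma cover_point_weight x y : Defs.cover point_weight x y = ind (f x y == z).
Proof.
rewrite /Defs.cover rsumE (@tsum_single _ _ ([set x], [set y])).
  rewrite /in_rect !inE !eqxx /= Rmult_1_l /point_weight; congr ind.
  apply/existsP/idP => [[p /andP[/eqP[/setP/(_ x) + /setP/(_ y)]]]|fz].
    by rewrite !inE !eqxx => /esym/eqP -> /esym/eqP ->.
  by exists (x, y); rewrite eqxx.
move=> S nS; rewrite /point_weight; case: (boolP (in_rect S x y)) => [|_] /=; last lra.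
case: existsP => /= [[p /andP[/eqP SE _]]|]; last by rewrite Rmult_0_r.
rewrite SE /in_rect !inE => /andP[/eqP xE /eqP yE].
by rewrite SE xE yE eqxx in nS.
Qed.

Lemma point_weight_feasible : srec_feasible mu f z eps delta point_weight.
Proof.
split; first by move=> S; exact: ind_ge0.
split; last first.
  by split=> x y; rewrite cover_point_weight; case: eqP => //= _; lra.
have -> : rsum (fun p : X * Y => f p.1 p.2 == z)
    (fun p => mu p.1 p.2 * Defs.cover point_weight p.1 p.2) = mu_z mu f z.
  by apply: eq_bigr => p fp; rewrite cover_point_weight fp Rmult_1_r.
have : 0 <= mu_z mu f z.
  rewrite /mu_z rsumE; apply: tsum_ge0 => p.
  by apply: Rmult_le_pos => //; exact: ind_ge0.
by move=> m0; have := Rmult_le_pos _ _ eps_ge0 m0; lra.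
Qed.

(** Completeness of the reals is applied to the negated values, which are bounded above by 0. *)
Lemma srec_z_is_inf : is_inf (fun s => exists w : rect X Y -> R,
  srec_feasible mu f z eps delta w /\ s = tsum w) (srec_z mu f z eps delta).
Proof.
apply: (epsilon_spec (inhabits R0)).
pose E s := exists w : rect X Y -> R,
  srec_feasible mu f z eps delta w /\ s = - tsum w.
have [||m [ub lub]] := @completeness E.
- exists 0 => s [w [[w0 _] ->]]; have := tsum_ge0 w0; lra.
- by exists (- tsum point_weight), point_weight; split=> //; exact: point_weight_feasible.
exists (- m); split.
  by move=> s [w [fw ->]]; have := ub _ (ex_intro _ w (conj fw erefl)); lra.
move=> b hb; suff : m <= - b by lra.
by apply: lub => s [w [fw ->]]; have := hb _ (ex_intro _ w (conj fw erefl)); lra.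
Qed.

(** A slack of 1 replaces attainment of the optimum; it is later absorbed by one doubling of the
    bound on [srec]. *)
Lemma srec_z_approx : exists w : rect X Y -> R,
  srec_feasible mu f z eps delta w /\ tsum w <= srec_z mu f z eps delta + 1.
Proof.
have [_ glb] := srec_z_is_inf; apply: NNPP => /not_ex_all_not none.
suff : srec_z mu f z eps delta + 1 <= srec_z mu f z eps delta by lra.
apply: glb => s [w [fw ->]]; apply: Rlt_le; apply: Rnot_le_lt => h.
by apply: (none w).
Qed.

End SmoothRectangleBound.

(** * Choice of parameters and the resulting protocol *)

Lemma bernoulli_decay p n : 0 <= p <= 1 -> (1 - p) ^ n * (1 + INR n * p) <= 1.
Proof.
move=> [p0 p1]; elim: n => [|n IHn]; first by rewrite /=; lra.
apply: Rle_trans IHn; rewrite S_INR.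
have -> : (1 - p) ^ n.+1 = (1 - p) ^ n * (1 - p) by rewrite /=; ring.
rewrite Rmult_assoc; apply: Rmult_le_compat_l; first by apply: pow_le; lra.
have := pos_INR n; nra.
Qed.

Lemma INR_expn m n : INR (expn m n) = INR m ^ n.
Proof. by elim: n => [|n IHn] //; rewrite expnS mult_INR IHn. Qed.

Lemma INR_le_pow2 n : INR n <= 2 ^ n.
Proof.
have -> : 2 = INR 2 by [].
by rewrite -INR_expn; apply/le_INR/leP/ltnW/ltn_expl.
Qed.

Lemma deficit_bound d m0 m1 A0 A1 : 1 = m0 + m1 ->
  A0 >= (1 - d) * m0 -> A1 >= (1 - d) * m1 -> 1 + -1 * (A0 + A1) <= d.
Proof.
move=> e; have : d * (m0 + m1) = d by rewrite -e Rmult_1_r.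
by lra.
Qed.

(** With [N = 3200 k] phases the error is at most 1/4 from the final constant, 1/6400 from the
    deficit and [160 (k + 1) / N <= 1/20 + 1/400] from the potential, in all below 49/100. *)
Lemma distributional_protocol (X Y : finType) (mu : X -> Y -> R) f k delta :
  product_distribution mu -> (20 <= k)%N -> 0 <= delta <= 1 / 6400 ->
  (forall z, srec_z mu f z delta delta + 1 <= 2 ^ k) ->
  exists P : protocol X Y, INR (depth P) <= 19200 * INR k ^ 2 /\ error mu f P <= 49 / 100.
Proof.
move=> [mu0 [mu1 [muX [muY muE]]]] k20 [d0 d1] hs.
have [w hw] : exists w : bool -> rect X Y -> R, forall z,
    srec_feasible mu f z delta delta (w z) /\ tsum (w z) <= 2 ^ k.
  have [w0 [f0 t0]] := @srec_z_approx X Y mu f false delta delta mu0 d0 d0.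
  have [w1 [f1 t1]] := @srec_z_approx X Y mu f true delta delta mu0 d0 d0.
  exists (fun z => if z then w1 else w0) => -[]; split => //.
    exact: (Rle_trans _ _ _ t1 (hs true)).
  exact: (Rle_trans _ _ _ t0 (hs false)).
(* The given factors may be negative; their absolute values still multiply to [mu], which is
   nonnegative. *)
pose a x := Rabs (muX x); pose b y := Rabs (muY y).
have a0 x : 0 <= a x by exact: Rabs_pos.
have b0 y : 0 <= b y by exact: Rabs_pos.
have abE x y : a x * b y = mu x y.
  by rewrite -Rabs_mult -muE Rabs_pos_eq.
have w0 z S : 0 <= w z S by have [[]] := hw z.
have wl z : tsum (w z) <= 2 ^ k by have [] := hw z.
have c1 z x y : Defs.cover (w z) x y <= 1 by have [[_ [_ [_]]]] := hw z.
have W1 : 1 <= 2 ^ k by apply: pow_R1_Rle; lra.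
have cg z x y : 0 <= Defs.cover (w z) x y by exact: cover_ge0.
(* Every point lies outside one of the two fibers; the cover for that fiber is at most [delta]
   there, the other at most 1. *)
have conf x y : Defs.cover (w false) x y * Defs.cover (w true) x y <= 1 / 6400.
  have [z fz] : exists z, f x y <> z by exists (~~ f x y); case: (f x y).
  have cz : Defs.cover (w z) x y <= delta by have [[_ [_ [h _]]] _] := hw z; exact: h.
  by case: z fz cz => _ cz; have := c1 true x y; have := c1 false x y;
    have := cg true x y; have := cg false x y; nra.
pose v : rect X Y := (setT, setT).
have inv p : inrect v p by rewrite /inrect /in_rect !inE.
have intE g : integral a b (inrect v) g = tsum (fun p => mu p.1 p.2 * g p).
  by apply: eq_tsum => p; rewrite inv abE /= Rmult_1_l.
have mass1 : mass a b v = 1.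
  by rewrite /mass intE -[RHS]mu1; apply: eq_tsum => p; rewrite Rmult_1_r.
have def1 : deficit a b f w v <= delta.
  have split_sum (g : bool -> X * Y -> R) :
      tsum (fun p => g (f p.1 p.2) p) =
      rsum (fun p : X * Y => f p.1 p.2 == false) (g false)
      + rsum (fun p : X * Y => f p.1 p.2 == true) (g true).
    rewrite [X in _ = X + _]rsumE [X in _ = _ + X]rsumE -tsumD; apply: eq_tsum => p.
    by case: (f p.1 p.2) => /=; ring.
  rewrite /deficit intE.
  have [[_ [h0 _]] _] := hw false; have [[_ [h1 _]] _] := hw true.
  have := split_sum (fun z p => mu p.1 p.2 * Defs.cover (w z) p.1 p.2).
  have := split_sum (fun _ p => mu p.1 p.2).
  rewrite -/(mu_z mu f false) -/(mu_z mu f true) mu1 => e1 e2.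
  rewrite (eq_tsum (G := fun p => mu p.1 p.2
    + -1 * (mu p.1 p.2 * Defs.cover (w (f p.1 p.2)) p.1 p.2))); last first.
    by move=> p; ring.
  rewrite tsumD tsumZ mu1 e2; move: (e1) h0 h1.
  exact: deficit_bound.
have pot1 : pot a b (w false) v <= INR k + 1.
  have lnW : ln (2 ^ k) <= INR k.
    rewrite ln_pow; last lra.
    have := @ln_le_sub1 2; have := pos_INR k; nra.
  suff : pot a b (w false) v <= ln (2 ^ k) + 1 by lra.
  apply: pot_le => //.
  rewrite -[X in _ <= X]mass1; apply: ler_int => // p _; exact: c1.
have k20' : 20 <= INR k by have := le_INR _ _ (leP k20); rewrite /=; lra.
have [N NE] : exists N, INR N = 3200 * INR k.
  exists (Z.to_nat 3200 * k)%N; rewrite mult_INR; congr (_ * _).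
  by rewrite INR_IZR_INZ Z2Nat.id.
(* Large enough that [2 ^ L / (20 * 2 ^ k) = 2 ^ k * (2 ^ 18 / 20)] exceeds [4 N = 12800 k], while
   the depth [N * 2 L = 12800 k ^ 2 + 115200 k] stays below [19200 k ^ 2] for [k >= 20]. *)
pose L := (2 * k + 18)%N.
have decay : (1 - / (20 * 2 ^ k)) ^ (expn 2 L) <= / (4 * INR N).
  have p1 : / (20 * 2 ^ k) <= / 1 by apply: Rinv_le_contravar; lra.
  have p0 : 0 < / (20 * 2 ^ k) by apply: Rinv_0_lt_compat; lra.
  rewrite Rinv_1 in p1.
  have big : 4 * INR N <= 1 + INR (expn 2 L) * / (20 * 2 ^ k).
    rewrite INR_expn NE /L pow_add mulnC pow_mult.
    have -> : INR 2 = 2 by [].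
    have -> : ((2 ^ k) ^ 2 * 2 ^ 18) * / (20 * 2 ^ k) = 2 ^ k * (2 ^ 18 / 20).
      by field; lra.
    have := INR_le_pow2 k; rewrite (_ : 2 ^ 18 = 262144); last by ring.
    by lra.
  have N0 : 0 < 4 * INR N by lra.
  have := bernoulli_decay (expn 2 L) (conj (Rlt_le _ _ p0) p1).
  set x := _ ^ _ => hx; apply: (Rmult_le_reg_r (4 * INR N)) => //.
  rewrite Rinv_l; last lra.
  apply: Rle_trans hx; apply: Rmult_le_compat_l => //.
  by apply: pow_le; lra.
have N2 : (2 <= N)%N by apply/leP/INR_le; rewrite NE /=; lra.
have [P [dP eP]] := iterated_protocol a0 b0 f w0 W1 (wl true) c1 conf v N2 (leqnn N) decay.
exists P; split.
  move/leP/le_INR: dP; rewrite /L !mult_INR plus_INR mult_INR NE.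
  rewrite (_ : INR 2 = 2) // (_ : INR 18 = 18); last by rewrite /=; ring.
  nra.
have -> : error mu f P = err a b f (inrect v) P.
  rewrite /err intE /error rsumE; apply: eq_tsum => p; ring.
apply: (Rle_trans _ _ _ eP); rewrite /budget mass1.
have -> : INR N * (3 / (4 * INR N)) = 3 / 4 by field; lra.
have : 160 / INR N * pot a b (w false) v <= 160 / INR N * (INR k + 1).
  apply: Rmult_le_compat_l => //; apply: Rlt_le; apply: Rdiv_lt_0_compat; lra.
have -> : 160 / INR N * (INR k + 1) = / 20 + / 20 * / INR k by rewrite NE; field; lra.
have : / INR k <= / 20 by apply: Rinv_le_contravar; lra.
by lra.
Qed.

(** * The trivial protocol *)

Lemma trivial_protocol (X Y : finType) (f : X -> Y -> bool) j (A : {set X}) :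
  (#|A| <= expn 2 j)%N -> exists P : protocol X Y,
  (depth P <= j.+1)%N /\ forall x y, x \in A -> run P x y = f x y.
Proof.
elim: j A => [|j IHj] A cA.
  (* Alice's halving has left at most one row, known to both players; one bit from Bob gives the
     value, hence the depth [j.+1]. *)
  have [x0 x0A|A0] := pickP (mem A); last first.
    by exists (Leaf _ _ true); split=> // x y xA; have := A0 x; rewrite /= xA.
  exists (BobNode (f x0) (Leaf _ _ false) (Leaf _ _ true)); split=> // x y xA.
  have /card_le1P/(_ _ x0A) A1 := cA; move: xA; rewrite A1 inE => /eqP -> /=.
  by case: (f x0 y).
set m := expn 2 j in IHj.
pose A1 := [set x in take m (enum A)]; pose A2 := [set x in drop m (enum A)].
have [|P1 [d1 h1]] := IHj A1.
  rewrite cardsE; apply: (leq_trans (card_size _)).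
  by rewrite size_take; case: ltnP.
have [|P2 [d2 h2]] := IHj A2.
  rewrite cardsE; apply: (leq_trans (card_size _)).
  by rewrite size_drop -cardE leq_subLR addnn -mul2n -expnS.
exists (AliceNode (fun x => x \in A1) P2 P1); split.
  by rewrite /= ltnS geq_max d1 d2.
move=> x y xA /=; case: ifP => [xA1|xA1]; first exact: h1.
apply: h2; rewrite inE; have : x \in take m (enum A) ++ drop m (enum A).
  by rewrite cat_take_drop mem_enum.
by rewrite mem_cat; move: xA1; rewrite inE => ->.
Qed.

Lemma CC_bits_le n (f : bits n -> bits n -> bool) mu eps : 0 <= eps ->
  (CC mu eps f <= n.+1)%N.
Proof.
move=> eps0; have [|P [dP hP]] := @trivial_protocol _ (bits n) f n setT.
  by rewrite cardsT card_tuple card_bool.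
apply: (leq_trans _ dP); apply: CC_le.
rewrite /error /rsum big_pred0 // => p.
by rewrite hP ?inE // eqxx.
Qed.

(** * From the value [srec] to the two bounds *)

Lemma Rceil_bounds x : x <= IZR (Rceil x) < x + 1.
Proof.
rewrite /Rceil /Rfloor opp_IZR minus_IZR.
by have := archimed (- x); lra.
Qed.

(** The factor 100 leaves ample room: [k / 100 <= k - 1], so [srec + 1 <= 2 ^ k] and near-optimal
    solutions have total weight at most [2 ^ k]. *)
Lemma CC_le_of_srec n (f : bits n -> bits n -> bool) mu k delta :
  product_distribution mu -> (20 <= k)%N -> 0 <= delta ->
  delta <= 1 / (3000 * (INR k + 1) ^ 4) ->
  100 * log2 (srec mu f delta delta) <= INR k ->
  INR (CC mu (49 / 100) f) <= 19200 * INR k ^ 2.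
Proof.
move=> mup k20 d0 d1 hs.
have k20' : 20 <= INR k by have := le_INR _ _ (leP k20); rewrite /=; lra.
have d2 : 0 <= delta <= 1 / 6400.
  split=> //; apply: (Rle_trans _ _ _ d1); rewrite /Rdiv !Rmult_1_l.
  apply: Rinv_le_contravar; first lra.
  have : 3 ^ 4 <= (INR k + 1) ^ 4 by apply: pow_incr; lra.
  by lra.
have p1 : 1 <= 2 ^ k.-1 by apply: pow_R1_Rle; lra.
have pE : 2 ^ k = 2 * 2 ^ k.-1.
  by rewrite -[in LHS](ltn_predK k20).
have l2 : 0 < ln 2 by have := ln_lt_2; lra.
have sl : srec mu f delta delta <= 2 ^ k.-1.
  (* [log2] carries no information about a nonpositive value, so that case is separate. *)
  case: (Rle_dec (srec mu f delta delta) 0) => [|/Rnot_le_lt s0]; first lra.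
  apply: Rnot_lt_le => /ln_increasing lt.
  have {lt} := lt (pow_lt 2 k.-1 ltac:(lra)).
  rewrite ln_pow; last lra.
  have -> : ln (srec mu f delta delta) = log2 (srec mu f delta delta) * ln 2.
    by rewrite /log2; field; lra.
  move=> /(Rmult_lt_reg_r _ _ _ l2).
  have : INR k = INR k.-1 + 1 by rewrite -S_INR (ltn_predK k20).
  by lra.
have [|P [dP eP]] := distributional_protocol (f := f) mup k20 d2.
  move=> z; have : srec_z mu f z delta delta <= srec mu f delta delta.
    by case: z; [exact: Rmax_r | exact: Rmax_l].
  by lra.
by apply: Rle_trans dP; exact/le_INR/leP/CC_le.
Qed.

Theorem mainTheorem4 :
  exists C : R,
  forall (n : nat), (2 <= n)%N ->
  forall (f : bits n -> bits n -> bool) (mu : bits n -> bits n -> R),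
  product_distribution mu ->
  (* (1) *)
  INR (CC mu (49/100) f)
    <= C * ((log2 (srec mu f (1 / (INR n)^2) (1 / (INR n)^2)))^2 * log2 (INR n) + 1)
  /\
  (* (2) *)
  (forall (k : nat) (delta : R),
     (20 <= k)%N ->
     0 <= delta ->
     delta <= 1 / (3000 * (INR k + 1)^4) ->
     (Rceil (100 * log2 (srec mu f delta delta)) <= Z.of_nat k)%Z ->
     INR (CC mu (49/100) f) <= C * (INR k)^2).
Proof.
exists (19200 * 40000) => n n2 f mu mup; split; last first.
  move=> k delta k20 d0 d1 /IZR_le; rewrite -INR_IZR_INZ => hk.
  apply: (@Rle_trans _ (19200 * INR k ^ 2)).
    apply: CC_le_of_srec d1 _ => //.
    by have := Rceil_bounds (100 * log2 (srec mu f delta delta)); lra.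
  by have := pow2_ge_0 (INR k); lra.
set d := 1 / INR n ^ 2; set l := log2 (srec mu f d d).
have n2' : 2 <= INR n by have := le_INR _ _ (leP n2); rewrite /=; lra.
have l2 : 0 < ln 2 by have := ln_lt_2; lra.
have logn : 1 <= log2 (INR n).
  rewrite /log2; apply: (Rmult_le_reg_r (ln 2)) => //.
  rewrite /Rdiv Rmult_assoc Rinv_l; last lra.
  case: (Rle_lt_or_eq_dec _ _ n2') => [lt|<-]; last lra.
  by have := ln_increasing 2 (INR n) ltac:(lra) lt; lra.
have d0 : 0 <= d by apply: Rlt_le; apply: Rdiv_lt_0_compat; [lra | apply: pow_lt; lra].
(* [k] is 20 or the ceiling of [100 * l]; in the second case [100 * l > 20], so rounding up stays
   below [200 * l]. *)
have [k [k20 lk k_le]] : exists k : nat,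
    [/\ (20 <= k)%N, 100 * l <= INR k & INR k ^ 2 <= 40000 * l ^ 2 + 400].
  case: (Rle_dec (100 * l) 20) => [le|/Rnot_le_lt gt].
    by exists 20%N; split=> //=; have := pow2_ge_0 l; lra.
  have [c1 c2] := Rceil_bounds (100 * l).
  have c0 : (20 <= Rceil (100 * l))%Z by apply: le_IZR; lra.
  have kE : INR (Z.to_nat (Rceil (100 * l))) = IZR (Rceil (100 * l)).
    by rewrite INR_IZR_INZ Z2Nat.id //; apply: Z.le_trans c0.
  exists (Z.to_nat (Rceil (100 * l))); rewrite kE; split=> //.
    by apply/leP/INR_le; rewrite kE /=; lra.
  have : IZR (Rceil (100 * l)) ^ 2 <= (200 * l) ^ 2 by apply: pow_incr; lra.
  by lra.
have k20' : 20 <= INR k by have := le_INR _ _ (leP k20); rewrite /=; lra.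
suff : INR (CC mu (49 / 100) f) <= 19200 * INR k ^ 2.
  have : l ^ 2 * 1 <= l ^ 2 * log2 (INR n).
    by apply: Rmult_le_compat_l => //; exact: pow2_ge_0.
  by lra.
(* If [n < 55 (k + 1) ^ 2], the [n + 1] bits of the trivial protocol suffice. Otherwise
   [55 ^ 2 = 3025 >= 3000] makes [1 / n ^ 2] small enough for [CC_le_of_srec]. *)
case: (Rle_dec (55 * (INR k + 1) ^ 2) (INR n)) => [le|/Rnot_le_lt lt]; last first.
  have := le_INR _ _ (leP (@CC_bits_le n f mu (49 / 100) ltac:(lra))).
  by rewrite S_INR; nra.
apply: CC_le_of_srec lk => //.
rewrite /d /Rdiv !Rmult_1_l; apply: Rinv_le_contravar.
  by apply: Rmult_lt_0_compat; [lra | apply: pow_lt; lra].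
have : (55 * (INR k + 1) ^ 2) ^ 2 <= INR n ^ 2.
  by apply: pow_incr; split=> //; have := pow2_ge_0 (INR k + 1); lra.
have -> : (55 * (INR k + 1) ^ 2) ^ 2 = 3025 * (INR k + 1) ^ 4 by ring.
have : 0 <= (INR k + 1) ^ 4 by apply: pow_le; lra.
by lra.
Qed.
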